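(* Let $p$ be a prime, let $s\ge0$ be an integer, let $\sigma_{jm}\in\mathbb{C}$ with $|\sigma_{jm}|=1$ ($1\le j\le p-1$, $0\le m\le p^s-1$), and let $Z=(z_{j\nu})$ be a $(p-1)\times(p-1)$ unitary matrix. Let $\psi_j$, $j=1,\ldots,p-1$, be the Haar-type wavelet functions $$\psi_j(x)=\sum_{\nu=1}^{p-1}\sum_{k=0}^{p^s-1}\alpha_{\nu,k}^{j}\,\psi_\nu^{(0)}\!\left(x-\frac{k}{p^s}\right),\quad x\in\mathbb{Q}_p,$$ with coefficients $\alpha_{\nu,k}^j$ and functions $\psi^{(0)}_\nu$ as given in the context, and let $h_j(0)=\sum_{\nu=1}^{p-1}\alpha_{\nu,0}^{j}$. Then each $\psi_j$ always has $1$ $p$-vanishing moment. Moreover, for $j=1,\ldots,p-1$, $\psi_j$ has an infinite number of $p$-vanishing moments if and only if $h_j(0)=0$.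
   Context: $|\cdot|_p$ is the $p$-adic absolute value on $\mathbb{Q}_p$, $dx$ is the Haar measure for which $B_0(0)=\{x: |x|_p\le1\}$ has measure $1$, and $\phi=1_{B_0(0)}$. For $\nu=1,\ldots,p-1$, $$\psi_\nu^{(0)}(x)=\sum_{r=0}^{p-1}e^{2\pi i\nu r/p}\,\phi\!\left(\frac{x}{p}-\frac{r}{p}\right).$$ The coefficients are $$\alpha_{\nu,k}^{j}=\begin{cases}-p^{-s}\displaystyle\sum_{m=0}^{p^s-1}e^{-2\pi i\frac{-\frac{\nu}{p}+m}{p^s}k}\,\sigma_{jm}z_{jj}, & j=\nu,\\[2mm] p^{-2s}\displaystyle\sum_{m=0}^{p^s-1}\sum_{n=0}^{p^s-1}e^{-2\pi i\frac{-\frac{\nu}{p}+m}{p^s}k}\left(\frac{1-e^{2\pi i\frac{j-\nu}{p}}}{e^{2\pi i\frac{\frac{j-\nu}{p}+m-n}{p^s}}-1}\right)\sigma_{\nu m}z_{\nu j}, & j\ne\nu.\end{cases}$$ Equivalently $\psi_j(x)=\sum_{l=0}^{p^{s+1}-1}h_j\!\left(\frac{l}{p^{s+1}}\right)\phi\!\left(\frac{x}{p}-\frac{l}{p^{s+1}}\right)$ with $h_j\!\left(\frac{k+rp^s}{p^{s+1}}\right)=\sum_{\nu=1}^{p-1}\alpha_{\nu,k}^{j}e^{2\pi i\nu r/p}$ for $0\le r\le p-1$, $0\le k\le p^s-1$. A compactly supported $f\in L_2(\mathbb{Q}_p)$ has $k$ $p$-vanishing moments ($k$ a positive integer) if $\int_{\mathbb{Q}_p}|x|_p^\mu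 f(x)\,dx=0$ for all integers $0\le\mu<k$ (with $|x|_p^0=1$); it has an infinite number of $p$-vanishing moments if this holds for every positive integer $k$. *)

(* Defs.v *)
From HB Require Import structures.
From mathcomp Require Import all_boot all_order all_algebra.
From mathcomp Require Import all_classical all_reals all_analysis.
From mathcomp Require Import complex zify ring.
Import numFieldNormedType.Exports.
Import Order.TTheory GRing.Theory Num.Theory.
Set Implicit Arguments.
Unset Strict Implicit.
Unset Printing Implicit Defensive.
Local Open Scope classical_set_scope.
Local Open Scope ring_scope.

(* Since [logn p _ = 0] when [p] is not prime, [rat_padic_norm p] is then the
   trivial absolute value; thus everything up to the field [Qp p] makes sense
   for an arbitrary [p : nat]. *)
Definition rat_padic_val (p : nat) (q : rat) : int :=
  (logn p `|numq q|)%:Z - (logn p `|denq q|)%:Z.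

Definition rat_padic_norm (p : nat) (q : rat) : rat :=
  if q == 0 then 0 else p%:R ^ (- rat_padic_val p q).

Section RatPadicNorm.
Variable p : nat.
Local Notation val := (rat_padic_val p).
Local Notation nrm := (rat_padic_norm p).
Implicit Types q r : rat.

Let logz (a : int) := logn p `|a|%N.

Let logzM (a b : int) : a != 0 -> b != 0 -> logz (a * b) = (logz a + logz b)%N.
Proof. by move=> a0 b0; rewrite /logz abszM lognM // absz_gt0. Qed.

Let val0 q : ~~ prime p -> val q = 0.
Proof.
move=> /negbTE pp; have ln0 m : logn p m = 0%N by rewrite lognE pp.
by rewrite /val !ln0.
Qed.

Let val00 q : p = 0%N -> val q = 0.
Proof. by move=> p0; rewrite val0 // p0. Qed.

Lemma rat_padic_valM q r :
  q != 0 -> r != 0 -> val (q * r) = val q + val r.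
Proof.
move=> q0 r0; have nq := numq_eq0 q; have nr := numq_eq0 r.
have nqr := numq_eq0 (q * r).
have E : numq (q * r) * (denq q * denq r) = numq q * numq r * denq (q * r).
  apply/eqP; rewrite -(eqr_int rat) !rmorphM /= !numqE; apply/eqP; ring.
have := congr1 logz E.
rewrite !logzM ?mulf_neq0 ?denq_neq0 ?numq_eq0 ?mulf_neq0 // /val /logz; lia.
Qed.

Lemma rat_padic_valN q : val (- q) = val q.
Proof. by rewrite /val numqN denqN abszN. Qed.

Lemma rat_padic_valD q r : q != 0 -> r != 0 -> q + r != 0 ->
  (val q <= val (q + r)) || (val r <= val (q + r)).
Proof.
move=> q0 r0 qr0.
have [pp|pp] := boolP (prime p); last first.
  by rewrite !val0.
have E : numq (q + r) * (denq q * denq r) =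
         (numq q * denq r + numq r * denq q) * denq (q + r).
  apply/eqP; rewrite -(eqr_int rat) !(rmorphM, rmorphD) /= !numqE.
  by apply/eqP; ring.
have n0 : numq q * denq r + numq r * denq q != 0.
  apply/eqP => z0; move: E; rewrite z0 mul0r => /eqP.
  by rewrite !mulf_eq0 !(negbTE (denq_neq0 _)) numq_eq0 (negbTE qr0).
have := congr1 logz E.
rewrite !logzM ?mulf_neq0 ?denq_neq0 ?numq_eq0 // => E'.
have lz_ge k (a : int) : a != 0 -> (k <= logz a)%N = (p ^ k %| `|a|)%N.
  by move=> a0; rewrite /logz pfactor_dvdn // absz_gt0.
have minD (a b : int) : a != 0 -> b != 0 -> a + b != 0 ->
    (minn (logz a) (logz b) <= logz (a + b))%N.
  move=> a0 b0 ab0; rewrite lz_ge //.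
  have ha : (p ^ minn (logz a) (logz b) %| `|a|)%N by rewrite -lz_ge // geq_minl.
  have hb : (p ^ minn (logz a) (logz b) %| `|b|)%N by rewrite -lz_ge // geq_minr.
  have : ((p ^ minn (logz a) (logz b))%N%:Z %| a + b)%Z.
    by apply: rpredD; rewrite dvdzE.
  by rewrite dvdzE.
have := minD _ _ (mulf_neq0 (_ : numq q != 0) (denq_neq0 r))
                 (mulf_neq0 (_ : numq r != 0) (denq_neq0 q)) n0.
rewrite !numq_eq0 => /(_ q0 r0).
rewrite !logzM ?denq_neq0 ?numq_eq0 // geq_min => h.
rewrite /val -!/(logz _); move: h E'.
move: (logz (numq (q + r))) (logz (denq (q + r))) (logz (_ + _)) => a b c.
move: (logz (numq q)) (logz (denq q)) (logz (numq r)) (logz (denq r)).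
by move=> nq dq nr dr /orP[] h E'; apply/orP; [left|right]; lia.
Qed.

Lemma rat_padic_norm0 : nrm 0 = 0.
Proof. by rewrite /nrm eqxx. Qed.

Let pexp_gt0 q : 0 < (p%:R : rat) ^ (- val q).
Proof.
have [p0|p0] := posnP p; first by rewrite val00 // oppr0 expr0z.
by rewrite exprz_gt0 // ltr0n.
Qed.

Lemma rat_padic_norm_ge0 q : 0 <= nrm q.
Proof. by rewrite /nrm; case: ifP => // _; exact/ltW/pexp_gt0. Qed.

Lemma rat_padic_norm_eq0 q : (nrm q == 0) = (q == 0).
Proof.
by rewrite /nrm; case: ifP => _; rewrite ?eqxx ?gt_eqF.
Qed.

Lemma rat_padic_norm1 : nrm 1 = 1.
Proof. by rewrite /nrm oner_eq0 /val /= !logn1 subrr. Qed.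

Lemma rat_padic_normM q r : nrm (q * r) = nrm q * nrm r.
Proof.
have [->|q0] := eqVneq q 0; first by rewrite mul0r rat_padic_norm0 mul0r.
have [->|r0] := eqVneq r 0; first by rewrite mulr0 rat_padic_norm0 mulr0.
rewrite /nrm mulf_eq0 (negbTE q0) (negbTE r0) rat_padic_valM //=.
have [p0|p0] := posnP p; first by rewrite !val00 // oppr0 !expr0z mulr1.
by rewrite opprD expfzDr // pnatr_eq0 -lt0n.
Qed.

Lemma rat_padic_normN q : nrm (- q) = nrm q.
Proof. by rewrite /nrm oppr_eq0 rat_padic_valN. Qed.

Lemma rat_padic_normB q r : nrm (q - r) = nrm (r - q).
Proof. by rewrite -rat_padic_normN opprB. Qed.

Lemma rat_padic_normD q r : nrm (q + r) <= Num.max (nrm q) (nrm r).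
Proof.
have [->|q0] := eqVneq q 0.
  by rewrite add0r le_max lexx orbT.
have [->|r0] := eqVneq r 0.
  by rewrite addr0 le_max lexx.
have [->|qr0] := eqVneq (q + r) 0.
  by rewrite rat_padic_norm0 le_max rat_padic_norm_ge0.
have [p0|p0] := posnP p.
  by rewrite /nrm (negbTE q0) (negbTE r0) (negbTE qr0) !val00 // maxxx.
have p1 : 1 <= (p%:R : rat) by rewrite ler1n.
rewrite /nrm (negbTE q0) (negbTE r0) (negbTE qr0) le_max.
by case/orP: (rat_padic_valD q0 r0 qr0) => h; apply/orP; [left|right];
  rewrite ler_weXz2l // lerN2.
Qed.

Lemma rat_padic_normD_eq q r : nrm q < nrm r -> nrm (q + r) = nrm r.
Proof.
move=> qr; apply/eqP; rewrite eq_le; apply/andP; split.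
  by rewrite (le_trans (rat_padic_normD _ _)) // ge_max lexx ltW.
rewrite leNgt; apply/negP => h.
have := rat_padic_normD (q + r) (- q).
by rewrite addrC addKr rat_padic_normN leNgt gt_max h qr.
Qed.

End RatPadicNorm.

Definition padic_cauchy (p : nat) : {pred nat -> rat} := fun u =>
  `[< forall e : rat, 0 < e -> exists N, forall m n,
        (N <= m)%N -> (N <= n)%N -> rat_padic_norm p (u m - u n) < e >].

Definition padic_null (p : nat) : {pred nat -> rat} := fun u =>
  `[< forall e : rat, 0 < e -> exists N, forall n,
        (N <= n)%N -> rat_padic_norm p (u n) < e >].

Section CauchySequences.
Variable p : nat.
Local Notation nrm := (rat_padic_norm p).
Implicit Types u v : nat -> rat.

Lemma padic_cauchyP u : reflect
  (forall e : rat, 0 < e -> exists N, forall m n,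
     (N <= m)%N -> (N <= n)%N -> nrm (u m - u n) < e) (u \in padic_cauchy p).
Proof. exact: asboolP. Qed.

Lemma padic_nullP u : reflect
  (forall e : rat, 0 < e -> exists N, forall n, (N <= n)%N -> nrm (u n) < e)
  (u \in padic_null p).
Proof. exact: asboolP. Qed.

Lemma padic_cauchy_bounded u : u \in padic_cauchy p ->
  exists2 M : rat, 0 < M & exists N, forall n, (N <= n)%N -> nrm (u n) <= M.
Proof.
move=> /padic_cauchyP /(_ 1 ltr01) [N hN].
exists (Num.max 1 (nrm (u N))); first by rewrite lt_max ltr01.
exists N => n Nn; rewrite -[u n](subrK (u N)).
apply: le_trans (rat_padic_normD _ _ _) _.
by rewrite ge_max !le_max lexx orbT andbT ltW ?hN.
Qed.

Lemma padic_cauchy_norm u : u \in padic_cauchy p -> u \notin padic_null p ->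
  exists2 c : rat, 0 < c & exists N, forall n, (N <= n)%N -> nrm (u n) = c.
Proof.
move=> /padic_cauchyP hu /padic_nullP.
move=> /existsNP[e /not_implyP[e0 /forallNP hn]].
have [N hN] := hu e e0.
have /existsNP[n0 /not_implyP[Nn0 /negP]] := hn N; rewrite -leNgt => hn0.
exists (nrm (u n0)); first exact: lt_le_trans hn0.
exists N => n Nn; rewrite -[u n](subrK (u n0)) rat_padic_normD_eq //.
exact: lt_le_trans (hN _ _ Nn Nn0) hn0.
Qed.

Lemma padic_cauchy_subring : subring_closed (padic_cauchy p).
Proof.
split.
- apply/padic_cauchyP => e e0; exists 0%N => m n _ _.
  by rewrite subrr rat_padic_norm0.
- move=> u v /padic_cauchyP hu /padic_cauchyP hv.
  apply/padic_cauchyP => e e0.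
  have [M hM] := hu e e0; have [N hN] := hv e e0.
  exists (maxn M N) => m n; rewrite !geq_max => /andP[Mm Nm] /andP[Mn Nn].
  have -> : (u - v) m - (u - v) n = (u m - u n) - (v m - v n).
    by rewrite -[LHS]/((u m - v m) - (u n - v n)); ring.
  apply: le_lt_trans (rat_padic_normD _ _ _) _.
  by rewrite rat_padic_normN gt_max hM ?hN.
- move=> u v hu hv; have [A A0 [NA hA]] := padic_cauchy_bounded hu.
  have [B B0 [NB hB]] := padic_cauchy_bounded hv.
  move/padic_cauchyP in hu; move/padic_cauchyP in hv.
  apply/padic_cauchyP => e e0.
  have [M hM] := hu (e / B) (divr_gt0 e0 B0).
  have [N hN] := hv (e / A) (divr_gt0 e0 A0).
  exists (maxn (maxn NA NB) (maxn M N)) => m n.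
  rewrite !geq_max => /andP[/andP[am bm] /andP[Mm Nm]].
  move=> /andP[/andP[an bn] /andP[Mn Nn]].
  have -> : (u * v) m - (u * v) n = u m * (v m - v n) + (u m - u n) * v n.
    by rewrite -[LHS]/(u m * v m - u n * v n); ring.
  apply: le_lt_trans (rat_padic_normD _ _ _) _.
  rewrite !rat_padic_normM gt_max; apply/andP; split.
    apply: le_lt_trans (ler_wpM2r (rat_padic_norm_ge0 _ _) (hA _ am)) _.
    by rewrite mulrC -ltr_pdivlMr ?hN.
  apply: le_lt_trans (ler_wpM2l (rat_padic_norm_ge0 _ _) (hB _ bn)) _.
  by rewrite -ltr_pdivlMr ?hM.
Qed.

End CauchySequences.

HB.instance Definition _ (p : nat) :=
  GRing.isSubringClosed.Build (nat -> rat) (padic_cauchy p)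
    (padic_cauchy_subring p).

Record cauchy_seq (p : nat) :=
  CauchySeq { cauchy_val :> nat -> rat; _ : cauchy_val \in padic_cauchy p }.

HB.instance Definition _ (p : nat) := [isSub for @cauchy_val p].
HB.instance Definition _ (p : nat) := [Choice of cauchy_seq p by <:].
HB.instance Definition _ (p : nat) :=
  [SubChoice_isSubComNzRing of cauchy_seq p by <:].

Definition null_seq (p : nat) : {pred cauchy_seq p} :=
  fun u => (u : nat -> rat) \in padic_null p.

Lemma null_seq_ideal (p : nat) : idealr_closed (@null_seq p).
Proof.
split.
- by apply/padic_nullP => e e0; exists 0%N => n _; rewrite rat_padic_norm0.
- apply/negP => /padic_nullP /(_ 1 ltr01) [N /(_ N (leqnn N))].
  by rewrite rat_padic_norm1 ltxx.
- move=> a u v /padic_nullP hu /padic_nullP hv; apply/padic_nullP => e e0.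
  have [A A0 [NA hA]] := padic_cauchy_bounded (valP a).
  have [M hM] := hu (e / A) (divr_gt0 e0 A0); have [N hN] := hv e e0.
  exists (maxn NA (maxn M N)) => n; rewrite !geq_max => /and3P[an Mn Nn].
  apply: le_lt_trans (rat_padic_normD _ _ _) _; rewrite gt_max hN // andbT.
  rewrite rat_padic_normM.
  apply: le_lt_trans (ler_wpM2r (rat_padic_norm_ge0 _ _) (hA _ an)) _.
  by rewrite mulrC -ltr_pdivlMr ?hM.
Qed.

HB.instance Definition _ (p : nat) :=
  isIdealr.Build (cauchy_seq p) (@null_seq p) (null_seq_ideal p).

Definition Qp (p : nat) := {ideal_quot (@null_seq p)}.
HB.instance Definition _ (p : nat) := GRing.ComNzRing.on (Qp p).
HB.instance Definition _ (p : nat) := isPointed.Build (Qp p) 0.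

Section QpField.
Variable p : nat.
Local Notation nrm := (rat_padic_norm p).
Implicit Types (x y : Qp p) (u v : cauchy_seq p).

Local Notation cls := (\pi_(Qp p)%qT : cauchy_seq p -> Qp p).

Lemma Qp_pi_eq u v : (cls u == cls v) = (u - v \in @null_seq p).
Proof. by rewrite -[LHS](Quotient.idealrBE (@null_seq p)). Qed.

Lemma Qp_pi_eq0 u : (cls u == 0) = (u \in @null_seq p).
Proof. by rewrite -[0](rmorph0 cls) Qp_pi_eq subr0. Qed.

Lemma Qp_inverse x : x != 0 -> exists y, y * x = 1.
Proof.
rewrite -[x]reprK; set u := repr x => /negP.
rewrite Qp_pi_eq0 => /negP u0.
have [c c0 [N hN]] := padic_cauchy_norm (valP u) u0.
have uN n : (N <= n)%N -> u n != 0.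
  by move=> /hN h; rewrite -(rat_padic_norm_eq0 p) h gt_eqF.
have nV (a : rat) : a != 0 -> nrm a^-1 = (nrm a)^-1.
  move=> a0; apply/eqP; rewrite -(inj_eq (mulIf (_ : nrm a != 0))).
    by rewrite -rat_padic_normM !mulVf ?rat_padic_norm1 ?rat_padic_norm_eq0.
  by rewrite rat_padic_norm_eq0.
have vP : (fun n => (u n)^-1) \in padic_cauchy p.
  apply/padic_cauchyP => e e0.
  have /padic_cauchyP hu := valP u.
  have [M hM] := hu (e * (c * c)) (mulr_gt0 e0 (mulr_gt0 c0 c0)).
  exists (maxn N M) => m n; rewrite !geq_max => /andP[Nm Mm] /andP[Nn Mn].
  have -> : (u m)^-1 - (u n)^-1 = (u n - u m) * ((u m)^-1 * (u n)^-1).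
    by field; rewrite !uN.
  rewrite !rat_padic_normM !nV ?uN // !hN // -invfM -/(_ / _).
  by rewrite ltr_pdivrMr ?mulr_gt0 // hM.
exists (cls (CauchySeq vP)).
apply/eqP; rewrite -rmorphM -[1](rmorph1 cls) Qp_pi_eq.
apply/padic_nullP => e e0; exists N => n Nn.
rewrite -[X in nrm X]/((u n)^-1 * u n - 1).
by rewrite mulVf ?uN // subrr rat_padic_norm0.
Qed.

Definition Qp_inv x : Qp p := xget 0 [set y | y * x = 1].

Lemma Qp_mulVf x : x != 0 -> Qp_inv x * x = 1.
Proof. by move=> /Qp_inverse; exact: (@xgetPex _ 0 [set y | y * x = 1]). Qed.

Lemma Qp_inv0 : Qp_inv 0 = 0.
Proof.
rewrite /Qp_inv xgetPN // => y /eqP.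
by rewrite mulr0 eq_sym oner_eq0.
Qed.

End QpField.

HB.instance Definition _ (p : nat) :=
  GRing.ComNzRing_isField.Build (Qp p) (@Qp_mulVf p) (@Qp_inv0 p).

(* The absolute value is extended from [rat] to [Qp p] by continuity; it still
   takes rational values (0 and the powers of [p]). *)
Definition padic_abs (p : nat) (x : Qp p) : rat :=
  lim ((rat_padic_norm p (repr x n) : rat^o) @[n --> \oo]).

Section QpAbs.
Variable p : nat.
Local Notation nrm := (rat_padic_norm p).
Implicit Types (x y : Qp p) (u v : cauchy_seq p).

Local Notation cls := (\pi_(Qp p)%qT : cauchy_seq p -> Qp p).

Lemma padic_abs0 : padic_abs (0 : Qp p) = 0.
Proof.
apply: (@cvg_lim rat^o); first exact: norm_hausdorff.
have /eqP : cls (repr (0 : Qp p)) = 0 by rewrite reprK.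
rewrite Qp_pi_eq0 => /padic_nullP h.
apply/cvgrPdist_lt => e /h[N hN]; exists N => // n /hN.
by rewrite sub0r normrN ger0_norm ?rat_padic_norm_ge0.
Qed.

Lemma padic_abs_pi u : cls u != 0 -> exists2 N,
  0 < padic_abs (cls u) & forall n, (N <= n)%N -> nrm (u n) = padic_abs (cls u).
Proof.
move=> u0; set v := repr (cls u).
have vu : cls v = cls u by rewrite reprK.
have v0 : v \notin @null_seq p by rewrite -Qp_pi_eq0 vu.
have [c c0 [N hN]] := padic_cauchy_norm (valP v) v0.
have -> : padic_abs (cls u) = c.
  apply: (@cvg_lim rat^o); first exact: norm_hausdorff.
  apply/cvgrPdist_lt => e e0; exists N => // n /hN.
  by rewrite -/v => ->; rewrite subrr normr0.
have /padic_nullP /(_ c c0)[M hM] : (u - v) \in @null_seq p.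
  by rewrite -Qp_pi_eq vu.
exists (maxn N M) => // n; rewrite geq_max => /andP[Nn Mn].
have -> : u n = (u - v) n + v n by rewrite -[(u - v) n]/(u n - v n) subrK.
by rewrite rat_padic_normD_eq hN // hM.
Qed.

Lemma padic_abs_ge0 x : 0 <= padic_abs x.
Proof.
have [->|x0] := eqVneq x 0; first by rewrite padic_abs0.
by rewrite -[x]reprK; case: (@padic_abs_pi (repr x)); rewrite ?reprK // => N /ltW.
Qed.

Lemma padic_abs_eq0 x : (padic_abs x == 0) = (x == 0).
Proof.
have [->|x0] := eqVneq x 0; first by rewrite padic_abs0 eqxx.
rewrite gt_eqF //.
by rewrite -[x]reprK; case: (@padic_abs_pi (repr x)); rewrite ?reprK.
Qed.

Lemma padic_absM x y : padic_abs (x * y) = padic_abs x * padic_abs y.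
Proof.
have [->|x0] := eqVneq x 0; first by rewrite mul0r padic_abs0 mul0r.
have [->|y0] := eqVneq y 0; first by rewrite mulr0 padic_abs0 mulr0.
have xy0 := mulf_neq0 x0 y0; move: xy0 x0 y0; rewrite -[x]reprK -[y]reprK -rmorphM.
move=> /padic_abs_pi[K _ hK] /padic_abs_pi[N _ hN] /padic_abs_pi[M _ hM].
pose n := maxn K (maxn N M).
rewrite -(hK n) -?(hN n) -?(hM n) /n ?leq_max ?leqnn ?orbT //.
exact: rat_padic_normM.
Qed.

Lemma padic_absN x : padic_abs (- x) = padic_abs x.
Proof.
have [->|x0] := eqVneq x 0; first by rewrite oppr0.
have nx0 : - x != 0 by rewrite oppr_eq0.
move: nx0 x0; rewrite -[x]reprK -rmorphN.
move=> /padic_abs_pi[N _ hN] /padic_abs_pi[M _ hM].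
rewrite -(hN (maxn N M)) ?leq_maxl // -(hM (maxn N M)) ?leq_maxr //.
exact: rat_padic_normN.
Qed.

Lemma padic_abs_ratr (q : rat) : padic_abs (ratr q : Qp p) = nrm q.
Proof.
have nat_val n k : (n%:R : cauchy_seq p) k = n%:R.
  elim: n => // n IHn; rewrite !mulrS -[n%:R in RHS]IHn.
  by rewrite [LHS]/(1 + (n%:R : cauchy_seq p) k).
have absz (z : int) : padic_abs (z%:~R : Qp p) = nrm z%:~R.
  wlog [n ->] : z / exists n : nat, z = n.
    move=> wl; case: (intP z) => [|n|n]; [exact/wl/ex_intro | exact/wl/ex_intro|].
    by rewrite !rmorphN /= padic_absN rat_padic_normN; apply/wl; exists n.+1.
  rewrite -[_%:~R]/(n%:R) -[n%:~R]/(n%:R).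
  have [n0|n0] := eqVneq (n%:R : Qp p) 0.
    rewrite n0 padic_abs0; apply/esym/eqP; rewrite rat_padic_norm_eq0.
    apply: contraTT isT => nn0.
    have : (n%:R : cauchy_seq p) \in @null_seq p by rewrite -Qp_pi_eq0 rmorph_nat n0.
    move=> /padic_nullP/(_ (nrm n%:R)) [|N /(_ N (leqnn N))].
      by rewrite lt_def rat_padic_norm_eq0 nn0 rat_padic_norm_ge0.
    by rewrite nat_val ltxx.
  move: n0; rewrite -(rmorph_nat cls) => /padic_abs_pi[N _ /(_ N (leqnn N)) <-].
  by rewrite nat_val.
have d0 : nrm (denq q)%:~R != 0 by rewrite rat_padic_norm_eq0 intr_eq0 denq_neq0.
apply: (mulIf d0); rewrite -rat_padic_normM -numqE -!absz -padic_absM.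
by rewrite /ratr divfK // -padic_abs_eq0 absz.
Qed.

Lemma padic_absD x y :
  padic_abs (x + y) <= Num.max (padic_abs x) (padic_abs y).
Proof.
have [->|x0] := eqVneq x 0; first by rewrite add0r le_max lexx orbT.
have [->|y0] := eqVneq y 0; first by rewrite addr0 le_max lexx.
have [->|xy0] := eqVneq (x + y) 0.
  by rewrite padic_abs0 le_max padic_abs_ge0.
move: xy0 x0 y0; rewrite -[x]reprK -[y]reprK -rmorphD.
move=> /padic_abs_pi[K _ hK] /padic_abs_pi[N _ hN] /padic_abs_pi[M _ hM].
pose n := maxn K (maxn N M).
rewrite -(hK n) -?(hN n) -?(hM n) /n ?leq_max ?leqnn ?orbT //.
exact: rat_padic_normD.
Qed.

Definition padic_dist x y := padic_abs (x - y).

Lemma padic_distxx x : padic_dist x x = 0.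
Proof. by rewrite /padic_dist subrr padic_abs0. Qed.

Lemma padic_dist_eq0 x y : padic_dist x y = 0 -> x = y.
Proof. by move=> /eqP; rewrite padic_abs_eq0 subr_eq0 => /eqP. Qed.

Lemma padic_distC x y : padic_dist x y = padic_dist y x.
Proof. by rewrite /padic_dist -padic_absN opprB. Qed.

Lemma padic_dist_triangle y x z :
  padic_dist x z <= padic_dist x y + padic_dist y z.
Proof.
rewrite /padic_dist -(subrKA y x (- z)); apply: le_trans (padic_absD _ _) _.
by rewrite ge_max lerDl lerDr !padic_abs_ge0.
Qed.

End QpAbs.

HB.instance Definition _ (p : nat) := isMetric.Build rat (Qp p)
  (@padic_distxx p) (@padic_dist_eq0 p) (@padic_distC p)
  (@padic_dist_triangle p).

Definition Qp_borel (p : nat) := g_sigma_algebraType (@open (Qp p)).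

Definition unit_ball (p : nat) : set (Qp p) := [set x | padic_abs x <= 1].
Arguments unit_ball : clear implicits.

(* [Qp p] being locally compact and second countable, these two conditions
   determine a Borel measure: regularity and local finiteness need not be
   required separately. *)
Definition normalized_haar (R : realType) (p : nat)
    (mu : {measure set (Qp_borel p) -> \bar R}) : Prop :=
  (forall (a : Qp p) (A : set (Qp p)), measurable (A : set (Qp_borel p)) ->
     mu [set a + x | x in A] = mu A) /\
  mu (unit_ball p) = 1%E.

Section VanishingMoments.
Variables (R : realType) (p : nat).
Variable mu : {measure set (Qp_borel p) -> \bar R}.
Local Open Scope complex_scope.
Implicit Types f : Qp p -> R[i].

Definition complex_integral f : R[i] :=
  (\int[mu]_x complex.Re (f x)) +i* (\int[mu]_x complex.Im (f x)).

Definition compactly_supported f : Prop :=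
  compact (closure [set x | f x != 0]).

Definition square_integrable f : Prop :=
  [/\ measurable_fun setT (fun x : Qp_borel p => complex.Re (f x)),
      measurable_fun setT (fun x : Qp_borel p => complex.Im (f x)) &
      (\int[mu]_x ((ComplexField.Normc.normc (f x) ^+ 2)%:E) < +oo)%E].

Definition has_p_vanishing_moments (k : nat) f : Prop :=
  [/\ compactly_supported f, square_integrable f &
      forall m : nat, (m < k)%N ->
        complex_integral (fun x => (ratr (padic_abs x) ^+ m)%:C * f x) = 0].

Definition has_infinite_p_vanishing_moments f : Prop :=
  forall k : nat, (0 < k)%N -> has_p_vanishing_moments k f.

End VanishingMoments.

Section Wavelets.
Variables (R : realType) (p : nat).
Local Open Scope complex_scope.

Definition expi2pi (t : R) : R[i] :=
  cos (2 * pi * t) +i* sin (2 * pi * t).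

Definition phi (x : Qp p) : R[i] := (\1_(unit_ball p) x)%:C.

Definition psi0 (nu : nat) (x : Qp p) : R[i] :=
  \sum_(r < p) expi2pi (nu%:R * r%:R / p%:R) * phi (x / p%:R - r%:R / p%:R).

(* Indices ranging over 1, ..., p - 1 in the text are encoded in ['I_p.-1],
   with [j : 'I_p.-1] standing for [j.+1]. *)
Variables (s : nat) (sigma : 'I_p.-1 -> 'I_(p ^ s) -> R[i]) (Z : 'M[R[i]]_p.-1).

Definition alpha (j nu : 'I_p.-1) (k : nat) : R[i] :=
  if j == nu then
    - (p%:R ^- s) *
      \sum_(m < p ^ s)
        expi2pi (- ((- (nu.+1%:R / p%:R) + m%:R) / p%:R ^+ s * k%:R)) *
        sigma j m * Z j j
  else
    p%:R ^- (2 * s) *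
      \sum_(m < p ^ s) \sum_(n < p ^ s)
        expi2pi (- ((- (nu.+1%:R / p%:R) + m%:R) / p%:R ^+ s * k%:R)) *
        ((1 - expi2pi ((j.+1%:R - nu.+1%:R) / p%:R)) /
         (expi2pi (((j.+1%:R - nu.+1%:R) / p%:R + m%:R - n%:R) / p%:R ^+ s) - 1)) *
        sigma nu m * Z nu j.

Definition psi (j : 'I_p.-1) (x : Qp p) : R[i] :=
  \sum_(nu < p.-1) \sum_(k < p ^ s)
    alpha j nu k * psi0 nu.+1 (x - k%:R / p%:R ^+ s).

Definition h_at0 (j : 'I_p.-1) : R[i] := \sum_(nu < p.-1) alpha j nu 0.

End Wavelets.

(* Main.v *)
(* The function psi_j is a combination of indicators of the cosets
   k/p^s + r + p Z_p with coefficients alpha_{nu,k} e^{2 pi i nu r/p}.  On every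
   such coset other than p Z_p the function |x|_p is constant, with a value that
   does not depend on r.  Since sum_r e^{2 pi i nu r/p} = 0, only the deviation of
   p Z_p from this pattern contributes, and
     int |x|^m psi_j = h_j(0) (int_{p Z_p} |x|^m - mu(p Z_p)).
   The second factor vanishes for m = 0 and is negative for m >= 1. *)
Require Import Defs.
From mathcomp Require Import all_boot all_order all_algebra.
From mathcomp Require Import all_classical all_reals all_analysis.
From mathcomp Require Import measurable_realfun complex zify ring lra.
Import numFieldNormedType.Exports.
Import Order.TTheory GRing.Theory Num.Theory.
Set Implicit Arguments.
Unset Strict Implicit.
Unset Printing Implicit Defensive.
Local Open Scope classical_set_scope.
Local Open Scope ring_scope.

(** * Arithmetic of the p-adic absolute value and approximation by natural numbers *)

Section PadicNumbers.
Variables (p : nat) (p_prime : prime p).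
Local Notation nrm := (rat_padic_norm p).
Local Notation cls := (\pi_(Qp p)%qT : cauchy_seq p -> Qp p).
Implicit Types (x y : Qp p) (u : cauchy_seq p).

Let p_gt0 : 0 < (p%:R : rat).
Proof. by rewrite ltr0n prime_gt0. Qed.

Lemma padic_abs_int (z : int) : padic_abs (z%:~R : Qp p) = nrm z%:~R.
Proof. by rewrite -ratr_int padic_abs_ratr. Qed.

Lemma padic_abs_nat n : padic_abs (n%:R : Qp p) = nrm n%:R.
Proof. by rewrite -ratr_nat padic_abs_ratr. Qed.

Lemma padic_abs1 : padic_abs (1 : Qp p) = 1.
Proof. by rewrite (padic_abs_nat 1) rat_padic_norm1. Qed.

Lemma rat_padic_norm_prime : nrm p%:R = p%:R^-1.
Proof.
rewrite /rat_padic_norm pnatr_eq0 gtn_eqF ?prime_gt0 //.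
rewrite /rat_padic_val -[p%:R]/(p%:~R) numq_int denq_int /=.
by rewrite logn_prime // eqxx logn1 subr0 exprN1.
Qed.

Lemma padic_abs_prime : padic_abs (p%:R : Qp p) = p%:R^-1.
Proof. by rewrite padic_abs_nat rat_padic_norm_prime. Qed.

Lemma Qp_prime_neq0 : (p%:R : Qp p) != 0.
Proof. by rewrite -padic_abs_eq0 padic_abs_prime invr_eq0 gt_eqF. Qed.

Lemma padic_absX x n : padic_abs (x ^+ n) = padic_abs x ^+ n.
Proof.
elim: n => [|n IH]; first by rewrite !expr0 padic_abs1.
by rewrite !exprS padic_absM IH.
Qed.

Lemma padic_absV x : padic_abs x^-1 = (padic_abs x)^-1.
Proof.
have [->|x0] := eqVneq x 0; first by rewrite invr0 padic_abs0 invr0.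
apply: (@mulIf _ (padic_abs x)); first by rewrite padic_abs_eq0.
by rewrite -padic_absM !mulVf ?padic_abs_eq0 // padic_abs1.
Qed.

Lemma padic_absB x y : padic_abs (x - y) = padic_abs (y - x).
Proof. by rewrite -padic_absN opprB. Qed.

Lemma padic_abs_lt (e : rat) x y :
  padic_abs x < e -> padic_abs y < e -> padic_abs (x + y) < e.
Proof. by move=> xe ye; apply: le_lt_trans (padic_absD _ _) _; rewrite gt_max xe. Qed.

Lemma padic_abs_le (e : rat) x y :
  padic_abs x <= e -> padic_abs y <= e -> padic_abs (x + y) <= e.
Proof. by move=> xe ye; apply: le_trans (padic_absD _ _) _; rewrite ge_max xe. Qed.

(** Were |x + y| < |y|, then y = -x + (x + y) would be a sum of two elements of absolute value below
    |y|. *)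
Lemma padic_absD_eq x y :
  padic_abs x < padic_abs y -> padic_abs (x + y) = padic_abs y.
Proof.
move=> xy; apply/eqP; rewrite eq_le; apply/andP; split.
  by rewrite padic_abs_le // ltW.
rewrite leNgt; apply/negP => h.
suff : padic_abs y < padic_abs y by rewrite ltxx.
by rewrite -{1}(addKr x y) padic_abs_lt // padic_absN.
Qed.

Lemma padic_abs_nat_le1 n : padic_abs (n%:R : Qp p) <= 1.
Proof.
elim: n => [|n IH]; first by rewrite padic_abs0.
by rewrite mulrS padic_abs_le // padic_abs1.
Qed.

(** A nonzero value is an integer power of p, and a negative exponent is at most -1. *)
Lemma rat_padic_norm_discrete (q : rat) : nrm q < 1 -> nrm q <= p%:R^-1.
Proof.
rewrite /rat_padic_norm; case: ifP => _; first by rewrite invr_ge0 ltW.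
have p1 : 1 < (p%:R : rat) by rewrite ltr1n prime_gt1.
rewrite -(expr0z p%:R) ltr_eXz2l // => v0.
by rewrite -exprN1 ler_eXz2l //; move: v0; lia.
Qed.

(** The norms along a representing Cauchy sequence are eventually constant; this transfers
    discreteness from [rat] to [Qp p]. *)
Lemma padic_abs_rat x : x != 0 -> exists q, padic_abs x = nrm q.
Proof.
rewrite -[x]reprK => /padic_abs_pi[N _ /(_ N (leqnn N)) <-].
by exists (repr x N).
Qed.

Lemma padic_abs_discrete x : padic_abs x < 1 -> padic_abs x <= p%:R^-1.
Proof.
have [->|/padic_abs_rat[q ->]] := eqVneq x 0.
  by rewrite padic_abs0 invr_ge0 ltW.
exact: rat_padic_norm_discrete.
Qed.

Lemma padic_abs_natlt n : (0 < n < p)%N -> padic_abs (n%:R : Qp p) = 1.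
Proof.
move=> /andP[n0 np]; rewrite padic_abs_nat /rat_padic_norm pnatr_eq0 gtn_eqF //.
rewrite /rat_padic_val -[n%:R]/(n%:~R) numq_int denq_int /= logn1 subr0.
by rewrite lognE p_prime n0 gtnNdvd //= oppr0 expr0z.
Qed.

(** The power of p dividing k is at most k, hence below p^s. This is what places k/p^s outside
    Z_p. *)
Lemma padic_abs_expn_lt s k : (0 < k < p ^ s)%N ->
  p%:R ^- s < padic_abs (k%:R : Qp p).
Proof.
move=> /andP[k0 ks]; rewrite padic_abs_nat /rat_padic_norm pnatr_eq0 gtn_eqF //.
rewrite /rat_padic_val -[k%:R]/(k%:~R) numq_int denq_int /= logn1 subr0.
have p1 : 1 < (p%:R : rat) by rewrite ltr1n prime_gt1.
rewrite exprnN ltr_eXz2l // ltrN2 ltz_nat.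
rewrite -(ltn_exp2l _ _ (prime_gt1 p_prime)); apply: leq_ltn_trans ks.
by rewrite dvdn_leq // pfactor_dvdnn.
Qed.

Lemma cauchy_seq_intE (z : int) k : (z%:~R : cauchy_seq p) k = z%:~R.
Proof.
have natE n : (n%:R : cauchy_seq p) k = n%:R.
  elim: n => // n IHn; rewrite !mulrS -[n%:R in RHS]IHn.
  by rewrite [LHS]/(1 + (n%:R : cauchy_seq p) k).
case: z => n; first by rewrite -[_%:~R]/(n%:R) natE.
rewrite NegzE !mulrNz -!pmulrn -natE.
by rewrite [LHS]/(- ((n.+1%:R : cauchy_seq p) k)).
Qed.

Lemma padic_abs_cls_le u (e : rat) N : 0 <= e ->
  (forall n, (N <= n)%N -> nrm (u n) <= e) -> padic_abs (cls u) <= e.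
Proof.
move=> e0 h; have [->|] := eqVneq (cls u) 0; first by rewrite padic_abs0.
move=> /padic_abs_pi[M _ hM].
by rewrite -(hM (maxn M N)) ?leq_maxl // h // leq_maxr.
Qed.

Lemma rat_padic_norm_dvd n (z : int) : ((p ^ n)%N%:Z %| z)%Z -> nrm z%:~R <= p%:R ^- n.
Proof.
move=> /dvdzP[w ->]; rewrite -padic_abs_int rmorphM /= padic_absM.
rewrite -[(p ^ n)%N%:~R]/((p ^ n)%:R) natrX padic_absX padic_abs_prime exprVn.
rewrite ler_piMl ?invr_ge0 ?exprn_ge0 ?(ltW p_gt0) //.
case: w => m; first exact: (padic_abs_nat_le1 m).
by rewrite NegzE mulrNz padic_absN; exact: padic_abs_nat_le1.
Qed.

(** The denominator of q is invertible modulo p^n, so q has a residue there. *)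
Lemma rat_padic_norm_approx n (q : rat) : nrm q <= 1 ->
  exists2 a, (a < p ^ n)%N & nrm (q - a%:R) <= p%:R ^- n.
Proof.
move=> q1.
(* In lowest terms p divides at most one of numerator and denominator; if it divided the
   denominator, the norm would exceed 1. *)
have pd : ~~ (p %| `|denq q|)%N.
  apply/negP => pd; have [q0|q0] := eqVneq q 0.
    by move: pd; rewrite q0 -[0]/(0%:~R) denq_int /= dvdn1 gtn_eqF ?prime_gt1.
  have pn : ~~ (p %| `|numq q|)%N.
    apply/negP => pn; have := coprime_num_den q.
    rewrite /coprime => /eqP g1.
    have : (p %| gcdn `|numq q| `|denq q|)%N by rewrite dvdn_gcd pn.
    by rewrite g1 dvdn1 gtn_eqF ?prime_gt1.
  have p1 : 1 < (p%:R : rat) by rewrite ltr1n prime_gt1.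
  move: q1; rewrite /rat_padic_norm (negbTE q0) -(expr0z p%:R) ler_eXz2l //.
  rewrite /rat_padic_val (lognE p `|numq q|) (negbTE pn) !andbF.
  have : (0 < logn p `|denq q|)%N by rewrite logn_gt0 mem_primes p_prime absz_gt0 denq_neq0.
  by lia.
have cop : coprimez (denq q) (p ^ n)%N.
  rewrite coprimezE /= coprime_sym; apply: coprimeXl.
  by rewrite prime_coprime.
have /coprimezP[[u v] /= uv] := cop.
(* By Bezout, [u] inverts [denq q] modulo p^n, so [b] is the residue of q. *)
pose b := ((numq q * u) %% (p ^ n)%N)%Z.
have pn0 : (p ^ n)%N%:Z != 0 by rewrite eqz_nat -lt0n expn_gt0 prime_gt0.
have b0 : 0 <= b by apply: modz_ge0.
have bl : b < (p ^ n)%N by apply: ltz_pmod; rewrite ltz_nat expn_gt0 prime_gt0.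
exists `|b|%N; first by rewrite -ltz_nat gez0_abs.
rewrite -[_%:R]/(`|b|%N%:~R) gez0_abs //.
have dn1 : nrm (denq q)%:~R = 1.
  rewrite /rat_padic_norm intr_eq0 (negbTE (denq_neq0 _)) /rat_padic_val numq_int denq_int.
  by rewrite lognE (negbTE pd) !andbF logn1.
(* Since [denq q] has norm 1, multiplying the difference by it keeps the norm and leaves an integer
   divisible by p^n. *)
rewrite -[leLHS]mulr1 -[X in _ * X <= _]dn1 -rat_padic_normM mulrBl -numqE -intrM -intrB.
apply: rat_padic_norm_dvd.
have -> : b = numq q * u - (numq q * u %/ (p ^ n)%N)%Z * (p ^ n)%N.
  by apply/eqP; rewrite eq_sym subr_eq addrC /b -divz_eq.
set c := (_ %/ _)%Z; apply/dvdzP; exists (numq q * v + c * denq q).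
rewrite -[X in X - _]mulr1 -uv; ring.
Qed.

(** A far term of a representing sequence has norm at most 1 and is within p^-n of all later terms,
    so its rational approximation serves for x. *)
Lemma padic_approx_nat n x : padic_abs x <= 1 ->
  exists2 a, (a < p ^ n)%N & padic_abs (x - a%:R) <= p%:R ^- n.
Proof.
rewrite -[x]reprK; set u := repr x => x1.
have e0 : 0 < (p%:R : rat) ^- n by rewrite invr_gt0 exprn_gt0.
have e1 : (p%:R : rat) ^- n <= 1.
  by rewrite invf_le1 ?exprn_gt0 // exprn_ege1 // ler1n prime_gt0.
have /padic_cauchyP /(_ _ e0)[N hN] := valP u.
(* The norms tend to 0 if the class is 0, and are eventually equal to its absolute value
   otherwise. *)
have [M uM] : exists M, forall m, (M <= m)%N -> nrm (u m) <= 1.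
  have [|] := eqVneq (cls u) 0.
    move=> /eqP; rewrite Qp_pi_eq0 => /padic_nullP /(_ 1 ltr01)[M hM].
    by exists M => m /hM /ltW.
  by move=> /padic_abs_pi[M _ hM]; exists M => m /hM ->.
have [a an ha] := rat_padic_norm_approx n (uM _ (leq_maxl M N)).
exists a => //; rewrite -(rmorph_nat cls) -rmorphB /=.
apply: (@padic_abs_cls_le _ _ N); first exact: ltW.
move=> m Nm; have -> : (u - a%:R) m = (u m - u (maxn M N)) + (u (maxn M N) - a%:R).
  rewrite subrKA -[(a%:R : rat)]/(a%:~R) -(cauchy_seq_intE a m).
  exact: erefl.
apply: le_trans (rat_padic_normD _ _ _) _; rewrite ge_max ha andbT.
by rewrite ltW // hN // leq_maxr.
Qed.

Lemma padic_residue x : padic_abs x <= 1 ->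
  exists r : 'I_p, padic_abs (x - r%:R) < 1.
Proof.
move=> /(padic_approx_nat 1)[a]; rewrite expn1 expr1 => ap h.
exists (Ordinal ap); apply: le_lt_trans h _.
by rewrite invf_lt1 ?ltr1n ?prime_gt1.
Qed.

End PadicNumbers.

(** An ultrafilter contains each set or its complement, so the covering sets can be discarded one by
    one until one belongs to [F]. *)
Lemma ultra_finite_cover (T : Type) (F : set_system T) (A : nat -> set T) N :
  UltraFilter F -> F [set x | exists2 i, (i < N)%N & A i x] ->
  exists i, F (A i).
Proof.
move=> FU; elim: N => [|N IH] FA.
  by have [x []] := filter_ex FA.
have [FN|FN] := in_ultra_setVsetC (A N) FU; first by exists N.
apply: IH; apply: filterS (filterI FA FN) => x [[i iN Ai] nA].
exists i => //; move: iN; rewrite ltnS leq_eqVlt => /orP[/eqP iN|//].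
by case: nA; rewrite -iN.
Qed.

(** * Topology of Q_p: compact discs and cosets of p Z_p *)

Section PadicTopology.
Variables (p : nat) (p_prime : prime p).
Local Notation nrm := (rat_padic_norm p).
Local Notation cls := (\pi_(Qp p)%qT : cauchy_seq p -> Qp p).
Implicit Types (x y : Qp p) (u : cauchy_seq p).

Let p_gt0 : 0 < (p%:R : rat).
Proof. by rewrite ltr0n prime_gt0. Qed.

Let pX_gt0 n : 0 < (p%:R : rat) ^- n.
Proof. by rewrite invr_gt0 exprn_gt0. Qed.

Lemma prime_expV_small (e : rat) : 0 < e ->
  exists N, forall n, (N <= n)%N -> (p%:R : rat) ^- n < e.
Proof.
move=> e0; exists (Num.bound e^-1) => n Nn.
rewrite -[e]invrK ltf_pV2 ?posrE ?invr_gt0 ?exprn_gt0 //.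
apply: lt_le_trans (archi_boundP _) _; first by rewrite invr_ge0 ltW.
rewrite -natrX ler_nat; apply: leq_trans Nn _.
exact/ltnW/ltn_expl/prime_gt1.
Qed.

(** Completeness with a rate: the sequence [a] is itself Cauchy in [rat], and its class is the
    limit. *)
Lemma padic_digits_limit (a : nat -> nat) :
  (forall n m, (n <= m)%N -> padic_abs ((a m)%:R - (a n)%:R : Qp p) <= p%:R ^- n) ->
  exists x, forall n, padic_abs (x - (a n)%:R) <= p%:R ^- n.
Proof.
move=> ha.
have ha' n m : (n <= m)%N -> nrm ((a m)%:R - (a n)%:R) <= p%:R ^- n.
  move=> /ha; rewrite -[X in padic_abs X]/((a m)%:~R - (a n)%:~R).
  by rewrite -rmorphB padic_abs_int rmorphB.
have cau : (fun n => (a n)%:R) \in padic_cauchy p.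
  apply/padic_cauchyP => e /prime_expV_small[N hN]; exists N => m n Nm Nn.
  rewrite -(subrKA (a N)%:R); apply: le_lt_trans (rat_padic_normD _ _ _) _.
  rewrite [X in Num.max _ X]rat_padic_normB gt_max.
  by rewrite !(le_lt_trans (ha' N _ _)) // hN.
exists (cls (CauchySeq cau)) => n.
rewrite -(rmorph_nat cls) -rmorphB /=.
apply: (@padic_abs_cls_le _ _ _ n); first exact: ltW.
move=> m nm; have -> : (CauchySeq cau - (a n)%:R) m = (a m)%:R - (a n)%:R.
  rewrite -[((a n)%:R : rat)]/((a n)%:~R) -(cauchy_seq_intE p (a n) m).
  exact: erefl.
exact: ha'.
Qed.

Lemma Qp_nbhsP x (P : set (Qp p)) : nbhs x P <->
  exists2 e : rat, 0 < e & forall y, padic_abs (x - y) < e -> P y.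
Proof. by split => [/nbhs_ballP|h]; [|apply/nbhs_ballP]. Qed.

Lemma Qp_openP (A : set (Qp p)) :
  (forall x, A x -> exists2 e : rat, 0 < e &
     forall y, padic_abs (x - y) < e -> A y) -> open A.
Proof. by move=> h; rewrite openE => x /h /Qp_nbhsP. Qed.

(** For each n finitely many discs of radius p^-n cover the ball, so an ultrafilter picks one of
    them; the chosen centres converge, and their limit is a limit of the ultrafilter. *)
Lemma compact_unit_ball : compact (unit_ball p).
Proof.
rewrite compact_ultra => F FU FA.
have ex n : exists a : nat, F [set x : Qp p | padic_abs (x - a%:R) <= p%:R ^- n].
  apply: (@ultra_finite_cover _ F _ (p ^ n)).
  by apply: filterS FA => x /(padic_approx_nat p_prime n).
have [a ha] := choice ex.
have [n m nm|x hx] := @padic_digits_limit a.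
  (* Two members of [F] intersect, and a common point bounds the distance between the two
     centres. *)
  have [x [xm xn]] := filter_ex (filterI (ha m) (ha n)).
  rewrite -(subrKA x) padic_abs_le // padic_absB //; apply: le_trans xm _.
  rewrite lef_pV2 ?posrE ?exprn_gt0 //.
  by rewrite ler_weXn2l // ler1n prime_gt0.
exists x; split.
  rewrite /unit_ball /= -(subrK (a 0%N)%:R x) padic_abs_le //.
  exact: padic_abs_nat_le1.
move=> P /Qp_nbhsP[e e0 h]; have [n /(_ n (leqnn n)) ne] := prime_expV_small e0.
apply: filterS (ha n) => y yn; apply: h; apply: le_lt_trans ne.
by rewrite -(subrKA (a n)%:R) padic_abs_le // padic_absB.
Qed.

Lemma padic_scale_continuous (c : Qp p) : continuous (fun x => c * x).
Proof.
move=> x P /Qp_nbhsP[e e0 h]; apply/Qp_nbhsP.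
have c1 : 0 < padic_abs c + 1 by rewrite ltr_wpDl // padic_abs_ge0.
exists (e / (padic_abs c + 1)); first exact: divr_gt0.
move=> y; rewrite ltr_pdivlMr // => xy; apply: h.
rewrite -mulrBr padic_absM; apply: le_lt_trans xy.
by rewrite mulrC ler_wpM2l ?padic_abs_ge0 // lerDl.
Qed.

Definition padic_disc n : set (Qp p) := [set x | padic_abs x <= p%:R ^+ n].

(** The disc is the dilate of the unit ball by p^-n, and dilations are continuous. *)
Lemma compact_padic_disc n : compact (padic_disc n).
Proof.
have -> : padic_disc n = [set p%:R ^- n * x | x in unit_ball p].
  have pn0 : (p%:R : Qp p) ^+ n != 0 by rewrite expf_neq0 // Qp_prime_neq0.
  have pn : padic_abs ((p%:R : Qp p) ^+ n) = p%:R ^- n.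
    by rewrite padic_absX padic_abs_prime // exprVn.
  apply/seteqP; split => [x xn|_ [x x1 <-]].
    exists (p%:R ^+ n * x); last by rewrite mulKf.
    by rewrite /unit_ball /= padic_absM pn mulrC ler_pdivrMr ?exprn_gt0 // mul1r.
  rewrite /padic_disc /= padic_absM padic_absV pn invrK.
  by rewrite ler_piMr // exprn_ge0 // ltW.
apply: continuous_compact compact_unit_ball.
exact/continuous_subspaceT/padic_scale_continuous.
Qed.

(** Off the disc x is nonzero, and the absolute value is constant on the open ball of radius |x|
    around x. *)
Lemma closed_padic_disc n : closed (padic_disc n).
Proof.
rewrite -[padic_disc n]setCK; apply: open_closedC; apply: Qp_openP => x /negP.
rewrite -ltNge => nx; exists (padic_abs x); first exact: lt_trans (exprn_gt0 _ p_gt0) nx.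
move=> y xy; have -> : (~` padic_disc n) y = (~ padic_abs y <= p%:R ^+ n) by [].
have -> : padic_abs y = padic_abs x by rewrite -(subrK x y) padic_absD_eq // padic_absB.
by apply/negP; rewrite -ltNge.
Qed.

Lemma compact_closure_sub_disc (A : set (Qp p)) n :
  A `<=` padic_disc n -> compact (closure A).
Proof.
move=> An; apply: (@subclosed_compact _ _ (padic_disc n)).
- exact: closed_closure.
- exact: compact_padic_disc.
- rewrite [X in _ `<=` X](closure_id _).1; last exact: closed_padic_disc.
  exact: closure_subset.
Qed.

(* The coset [a + p Z_p]. *)
Definition pball (a : Qp p) : set (Qp p) := [set x | padic_abs (x - a) < 1].

(** No absolute value lies strictly between 1/p and 1, so the strict bound by 1 is a weak bound by
    1/p; the rescaled form is the one occurring inside [phi]. *)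
Lemma pballE a x : pball a x = (padic_abs ((x - a) / p%:R) <= 1) :> Prop.
Proof.
rewrite padic_absM padic_absV padic_abs_prime // invrK -ler_pdivlMr // mul1r.
apply/propext; split; first exact: padic_abs_discrete.
by move=> /le_lt_trans; apply; rewrite invf_lt1 ?ltr1n ?prime_gt1.
Qed.

Lemma open_pball a : open (pball a).
Proof.
apply: Qp_openP => x xa; exists 1 => // y xy.
by rewrite /pball /= -(subrKA x) padic_abs_lt // padic_absB.
Qed.

Lemma padic_abs_pball a x : 1 <= padic_abs a -> pball a x ->
  padic_abs x = padic_abs a.
Proof.
by move=> a1 xa; rewrite -(subrK a x) padic_absD_eq //; apply: lt_le_trans a1.
Qed.

(** This yields Borel measurability of |x|. For c >= 0 the points of the set are nonzero, and the
    absolute value is locally constant there. *)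
Lemma open_padic_abs_gt (R : realType) (c : R) :
  open [set x : Qp p | c < ratr (padic_abs x)].
Proof.
have [c0|c0] := ltP c 0.
  apply: Qp_openP => x _; exists 1 => // y _ /=.
  by apply: lt_le_trans c0 _; rewrite ler0q padic_abs_ge0.
apply: Qp_openP => x /= cx; exists (padic_abs x).
  by rewrite -(ltr0q R); apply: le_lt_trans c0 cx.
move=> y xy; have -> // : padic_abs y = padic_abs x.
by rewrite -(subrK x y) padic_absD_eq // padic_absB.
Qed.

End PadicTopology.

(** * Roots of unity and their sums *)

Section RootsOfUnity.
Variable R : realType.
Local Open Scope complex_scope.

Lemma expi2piD (a b : R) : expi2pi (a + b) = expi2pi a * expi2pi b.
Proof.
rewrite /expi2pi mulrDr cosD sinD; simpc.
by congr (_ +i* _); rewrite addrC.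
Qed.

Lemma expi2pi0 : expi2pi (0 : R) = 1.
Proof. by rewrite /expi2pi mulr0 cos0 sin0. Qed.

Lemma expi2piX (a : R) n : expi2pi a ^+ n = expi2pi (a *+ n).
Proof. by elim: n => [|n IH]; rewrite ?expi2pi0 // exprS IH mulrS expi2piD. Qed.

Lemma expi2pi_nat n : expi2pi (n%:R : R) = 1.
Proof.
elim: n => [|n IH]; first exact: expi2pi0.
by rewrite -natr1 expi2piD IH mul1r /expi2pi mulr1 mulr_natl cos2pi sin2pi.
Qed.

(** The value 1 would give cos(2 pi a) = 1, hence sin(pi a)^2 = 0 by the double angle formula, while
    pi a lies strictly between 0 and pi. *)
Lemma expi2pi_neq1 (a : R) : 0 < a < 1 -> expi2pi a != 1.
Proof.
move=> /andP[a0 a1]; apply/negP => /eqP[c1 _].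
have : 0 < sin (pi * a).
  by apply: sin_gt0_pi; rewrite mulr_gt0 ?pi_gt0 // gtr_pMr ?pi_gt0.
move: c1; rewrite -mulrA mulr_natl cos_mulr2n => c1 s0.
have := cos2Dsin2 (pi * a).
move: c1; rewrite -mulr_natl => c1 E.
have : sin (pi * a) ^+ 2 = 0 by lra.
by move/eqP; rewrite expf_eq0 /= gt_eqF.
Qed.

(** A geometric sum of powers of w = e^{2 pi i nu/p}, where w differs from 1 and w^p = 1. *)
Lemma sum_expi2pi (p nu : nat) : (0 < nu < p)%N ->
  \sum_(r < p) expi2pi (nu%:R * r%:R / p%:R : R) = 0.
Proof.
move=> /andP[nu0 nup]; set w := expi2pi (nu%:R / p%:R : R).
have p0 : (0 : R) < p%:R by rewrite ltr0n (leq_trans _ nup).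
have w1 : w != 1.
  apply: expi2pi_neq1; apply/andP; split; first by rewrite divr_gt0 // ltr0n.
  by rewrite ltr_pdivrMr // mul1r ltr_nat.
have wE (r : 'I_p) : expi2pi (nu%:R * r%:R / p%:R : R) = w ^+ r.
  by rewrite /w expi2piX mulrAC mulr_natr.
under eq_bigr do rewrite wE.
apply/eqP; rewrite -(mulrI_eq0 _ (mulfI (_ : w - 1 != 0))) ?subr_eq0 //.
rewrite -subrX1 /w expi2piX -(mulr_natr (_ / _)) divfK; last by rewrite gt_eqF.
by rewrite expi2pi_nat subrr.
Qed.

End RootsOfUnity.

(** * Integration of complex linear combinations of real functions *)

Section ComplexLinearCombinations.
Variables (R : realType) (p : nat) (mu : {measure set (Qp_borel p) -> \bar R}).
Local Open Scope complex_scope.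

Lemma integrable_Rsum (I : Type) (r : seq I) (g : I -> Qp_borel p -> R) :
  (forall i, mu.-integrable setT (EFin \o g i)) ->
  mu.-integrable setT (EFin \o (fun x => \sum_(i <- r) g i x)).
Proof.
move=> hg; have -> : EFin \o (fun x => \sum_(i <- r) g i x) =
    (fun x => \sum_(i <- r) (g i x)%:E)%E.
  by apply/funext => x; rewrite /= sumEFin.
by apply: integrable_sum => // i _; exact: hg.
Qed.

Lemma Rintegral_sum (I : Type) (r : seq I) (g : I -> Qp_borel p -> R) :
  (forall i, mu.-integrable setT (EFin \o g i)) ->
  \int[mu]_x (\sum_(i <- r) g i x) = \sum_(i <- r) \int[mu]_x g i x.
Proof.
move=> hg; elim: r => [|i r IH].
  under eq_Rintegral do rewrite big_nil.
  by rewrite Rintegral_cst // mul0r big_nil.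
under eq_Rintegral do rewrite big_cons.
by rewrite RintegralD ?IH ?big_cons //; exact: integrable_Rsum.
Qed.

Lemma Re_lincomb (I : Type) (r : seq I) (c : I -> R[i]) (g : I -> R) :
  complex.Re (\sum_(i <- r) c i * (g i)%:C) = \sum_(i <- r) complex.Re (c i) * g i.
Proof.
elim: r => [|i r IH]; first by rewrite !big_nil.
rewrite !big_cons -IH; case: (c i) => a b; case: (\sum_(_ <- _) _) => u v /=.
by rewrite mulr0 subr0.
Qed.

Lemma Im_lincomb (I : Type) (r : seq I) (c : I -> R[i]) (g : I -> R) :
  complex.Im (\sum_(i <- r) c i * (g i)%:C) = \sum_(i <- r) complex.Im (c i) * g i.
Proof.
elim: r => [|i r IH]; first by rewrite !big_nil.
rewrite !big_cons -IH; case: (c i) => a b; case: (\sum_(_ <- _) _) => u v /=.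
by rewrite mulr0 add0r.
Qed.

Lemma integrable_scale (c : R) (g : Qp_borel p -> R) :
  mu.-integrable setT (EFin \o g) ->
  mu.-integrable setT (EFin \o (fun x => c * g x)).
Proof. by move=> hg; have := @integrableZl _ _ _ mu setT measurableT c _ hg. Qed.

(** The [g i] are real, so real and imaginary parts affect only the coefficients, and linearity of
    the real integral applies to each. *)
Lemma complex_integral_lincomb (I : Type) (r : seq I) (c : I -> R[i])
    (g : I -> Qp_borel p -> R) :
  (forall i, mu.-integrable setT (EFin \o g i)) ->
  complex_integral mu (fun x => \sum_(i <- r) c i * (g i x)%:C) =
  \sum_(i <- r) c i * (\int[mu]_x g i x)%:C.
Proof.
move=> hg; apply/eqP; rewrite eq_complex /=.
rewrite Re_lincomb Im_lincomb.
under eq_Rintegral do rewrite Re_lincomb.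
rewrite Rintegral_sum; last by move=> i; exact: integrable_scale.
under [X in _ && (X == _)]eq_Rintegral do rewrite Im_lincomb.
rewrite Rintegral_sum; last by move=> i; exact: integrable_scale.
by apply/andP; split; apply/eqP/eq_bigr => i _; rewrite RintegralZl.
Qed.

(** |f|^2 is the sum of the squares of the real and imaginary parts, each a real combination of
    indicators of sets of finite measure. *)
Lemma square_integrable_lincomb (I : Type) (r : seq I) (c : I -> R[i])
    (A : I -> set (Qp_borel p)) :
  (forall i, measurable (A i)) -> (forall i, (mu (A i) < +oo)%E) ->
  square_integrable mu (fun x => \sum_(i <- r) c i * (\1_(A i) x)%:C).
Proof.
move=> mA fA.
have lin (e : I -> R) : let f := fun x : Qp_borel p => \sum_(i <- r) e i * \1_(A i) x in
    measurable_fun setT f /\ mu.-integrable setT (EFin \o (fun x => f x * f x)).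
  move=> f; have iA i : mu.-integrable setT (EFin \o (fun x => e i * \1_(A i) x)).
    apply: integrable_scale; apply/integrableP; split.
      exact/measurable_EFinP/measurable_indic.
    under eq_integral do rewrite /= ger0_norm //.
    by rewrite integral_indic // setIT.
  have mf : measurable_fun setT f.
    by apply: measurable_sum => i; apply: measurable_funM => //; exact: measurable_indic.
  (* The square is a bounded factor times an integrable one; the bound is the sum of the absolute
     values of the [e i]. *)
  split=> //; have := @integrableMr _ _ _ mu setT measurableT f (EFin \o f) mf.
  apply; last exact: integrable_Rsum.
  exists (\sum_(i <- r) `|e i|); split; first exact: num_real.
  move=> M hM x _; apply: le_trans (ltW hM); apply: le_trans (ler_norm_sum _ _ _) _.
  apply: ler_sum => i _; rewrite normrM ler_piMr // indicE.
  by case: (_ \in _); rewrite ?normr1 ?normr0.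
have [mRe iRe] := lin (fun i => complex.Re (c i)).
have [mIm iIm] := lin (fun i => complex.Im (c i)).
split.
- by under eq_fun do rewrite Re_lincomb.
- by under eq_fun do rewrite Im_lincomb.
- have /integrableP[_] := integrableD measurableT iRe iIm.
  apply: le_lt_trans; rewrite le_eqVlt; apply/orP; left; apply/eqP.
  apply: eq_integral => x _ /=; rewrite ger0_norm; last by rewrite -!expr2 addr_ge0 ?sqr_ge0.
  congr EFin; rewrite -Re_lincomb -Im_lincomb; case: (\sum_(_ <- _) _) => a b /=.
  by rewrite sqr_sqrtr ?addr_ge0 ?sqr_ge0 // !expr2.
Qed.

End ComplexLinearCombinations.

(** * Haar measure of the cosets of p Z_p and moments over them *)

Section HaarMoments.
Variables (R : realType) (p : nat) (p_prime : prime p).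
Variable mu : {measure set (Qp_borel p) -> \bar R}.
Hypothesis mu_haar : normalized_haar mu.
Local Open Scope complex_scope.

Lemma measurable_open_Qp (A : set (Qp p)) :
  open A -> measurable (A : set (Qp_borel p)).
Proof. by move=> oA; apply: sub_sigma_algebra. Qed.

Lemma measurable_pball (a : Qp p) : measurable (pball a : set (Qp_borel p)).
Proof. by apply: measurable_open_Qp; apply: open_pball. Qed.

Lemma measurable_padic_abs (D : set (Qp_borel p)) :
  measurable_fun D (fun x : Qp_borel p => ratr (padic_abs x) : R).
Proof.
move=> mD; apply: (measurability _ (RGenOInfty.measurableE R)) => //.
move=> /= _ [_ [c ->] <-]; apply: measurableI => //; rewrite preimage_itvoy.
by apply: measurable_open_Qp; apply: open_padic_abs_gt.
Qed.

Lemma mu_pball (a : Qp p) : mu (pball a) = mu (pball 0).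
Proof.
have [inv _] := mu_haar; rewrite -(inv a (pball 0)); last exact: measurable_pball.
congr (mu _); apply/seteqP; split => [x xa|_ [x x0 <-]].
  by exists (x - a); [rewrite /pball /= subr0 | rewrite addrC subrK].
by move: x0; rewrite /pball /= subr0 addrAC subrr add0r.
Qed.

Lemma mu_pball_lty (a : Qp p) : (mu (pball a) < +oo)%E.
Proof.
rewrite mu_pball; apply: (@le_lt_trans _ _ (mu (unit_ball p))); last first.
  by case: mu_haar => _ ->; rewrite ltry.
apply: le_measure; rewrite ?inE; first exact: measurable_pball.
  (* Z_p is the union of the open cosets r + p Z_p with r < p, hence open and measurable. *)
  have -> : unit_ball p = \bigcup_(r : 'I_p) pball (r%:R : Qp p).
    apply/seteqP; split => [x /(padic_residue p_prime)[r xr]|x [r _ xr]].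
      by exists r.
    rewrite /unit_ball /= -(subrK r%:R x) padic_abs_le ?padic_abs_nat_le1 //.
    exact: ltW.
  apply: measurable_open_Qp; apply: bigcup_open => r _; exact: open_pball.
by move=> x; rewrite /pball /unit_ball /= subr0 => /ltW.
Qed.

(** All cosets have the same measure and countably many of them cover Z_p; if that measure were 0,
    then Z_p would be null instead of having measure 1. *)
Lemma mu_pball_gt0 (a : Qp p) : 0 < fine (mu (pball a)).
Proof.
rewrite fine_gt0 // mu_pball_lty andbT lt0e measure_ge0 andbT mu_pball.
apply/eqP => mu0; case: mu_haar => _.
have cov : unit_ball p `<=` \bigcup_n pball (n%:R : Qp p).
  by move=> x /(padic_residue p_prime)[r xr]; exists r.
have : (mu (\bigcup_n pball (n%:R : Qp p)) = 0)%E.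
  apply/negligibleP.
    by apply: bigcup_measurable => n _; exact: measurable_pball.
  apply: negligible_bigcup => n; apply/negligibleP; first exact: measurable_pball.
  exact: etrans (mu_pball _) mu0.
move=> U0 /eqP; apply/negP.
have mub : measurable (unit_ball p : set (Qp_borel p)).
  rewrite -[unit_ball p]setCK; apply: measurableC; apply: measurable_open_Qp.
  have := @closed_padic_disc p p_prime 0; rewrite /padic_disc expr0.
  exact: closed_openC.
have -> : mu (unit_ball p) = 0%E.
  apply/eqP; rewrite -measure_le0 -U0 le_measure ?inE //.
  by apply: bigcup_measurable => n _; exact: measurable_pball.
by rewrite eq_sym onee_neq0.
Qed.

Definition ball_moment m (a : Qp p) : R :=
  \int[mu]_(x in pball a) (ratr (padic_abs x) ^+ m).

Lemma padic_abs_pball_bounded (a : Qp p) :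
  exists2 M : R, 0 <= M & forall x, pball a x -> ratr (padic_abs x) <= M.
Proof.
exists (ratr (Num.max 1 (padic_abs a))).
  by rewrite ler0q le_max ler01.
move=> x xa; rewrite ler_rat -(subrK a x); apply: le_trans (padic_absD _ _) _.
by rewrite ge_max !le_max lexx orbT (ltW xa).
Qed.

Lemma integrable_moment m (a : Qp p) :
  mu.-integrable (pball a) (EFin \o (fun x => ratr (padic_abs x) ^+ m)).
Proof.
apply: measurable_bounded_integrable.
- exact: measurable_pball.
- exact: mu_pball_lty.
- by apply: measurable_funX; exact: measurable_padic_abs.
- have [M M0 hM] := padic_abs_pball_bounded a.
  exists (M ^+ m); split; first exact: num_real.
  move=> N hN x xa; apply: le_trans (ltW hN); rewrite ger0_norm.
    by rewrite lerXn2r ?nnegrE ?hM // ler0q padic_abs_ge0.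
  by rewrite exprn_ge0 // ler0q padic_abs_ge0.
Qed.

Lemma integrable_moment_indic m (a : Qp p) :
  mu.-integrable setT
    (EFin \o (fun x : Qp_borel p => ratr (padic_abs x) ^+ m * \1_(pball a) x)).
Proof.
have := (integrable_mkcond _ (measurable_pball a)).1 (integrable_moment m a).
by rewrite restrict_EFin patch_indic.
Qed.

Lemma Rintegral_moment_indic m (a : Qp p) :
  \int[mu]_x (ratr (padic_abs x) ^+ m * \1_(pball a) x) = ball_moment m a.
Proof. by rewrite [RHS]Rintegral_mkcond patch_indic. Qed.

Lemma ball_moment_off0 m (a : Qp p) : 1 <= padic_abs a ->
  ball_moment m a = ratr (padic_abs a) ^+ m * fine (mu (pball 0)).
Proof.
move=> a1; rewrite /ball_moment -(mu_pball a) -Rintegral_cst; last exact: measurable_pball.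
by apply: eq_Rintegral => x; rewrite inE => /(padic_abs_pball a1) ->.
Qed.

Lemma ball_moment0 (a : Qp p) : ball_moment 0 a = fine (mu (pball 0)).
Proof.
rewrite -(mu_pball a) -[RHS]mul1r -Rintegral_cst; last exact: measurable_pball.
(* The power with exponent 0 is 1 at x = 0 too, in accordance with |x|^0 = 1. *)
by apply: eq_Rintegral => x _; rewrite expr0.
Qed.

(** On p Z_p one has |x|^m <= |x| <= 1/p, so the moment is at most 1/p times the measure, which is
    positive. *)
Lemma ball_moment_lt m : (0 < m)%N -> ball_moment m 0 < fine (mu (pball 0)).
Proof.
move=> m0; apply: (@le_lt_trans _ _ (p%:R^-1 * fine (mu (pball 0)))).
  rewrite -Rintegral_cst; last exact: measurable_pball.
  apply: le_Rintegral.
  - exact: measurable_pball.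
  - exact: integrable_moment.
  (* Integrability of the constant 1/p on p Z_p, obtained by scaling the integrand of the zeroth
     moment. *)
  - have := integrable_scale p%:R^-1 (integrable_moment_indic 0 0).
    move=> /(integrableS measurableT (measurable_pball 0) (@subsetT _ _)).
    apply: eq_integrable; first exact: measurable_pball.
    by move=> x x0 /=; rewrite expr0 mul1r indicE x0 mulr1.
  - move=> x; rewrite /pball /= subr0 => /(padic_abs_discrete p_prime) x1.
    apply: (@le_trans _ _ (ratr (padic_abs x))).
      rewrite -(prednK m0) exprS ler_piMr ?ler0q ?padic_abs_ge0 //.
      apply: exprn_ile1; first by rewrite ler0q padic_abs_ge0.
      rewrite -(rmorph1 (@ratr R)) ler_rat; apply: le_trans x1 _.
      by rewrite invf_le1 ?ler1n ?ltr0n prime_gt0.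
    by rewrite -ratr_nat -fmorphV ler_rat.
rewrite gtr_pMl ?mu_pball_gt0 // invf_lt1 ?ltr1n ?ltr0n ?prime_gt0 //.
exact: prime_gt1.
Qed.

End HaarMoments.

(** * Coset decomposition and moments of psi_j *)

Section WaveletMoments.
Variables (R : realType) (p s : nat) (p_prime : prime p).
Variables (sigma : 'I_p.-1 -> 'I_(p ^ s) -> R[i]) (Z : 'M[R[i]]_p.-1).
Variable mu : {measure set (Qp_borel p) -> \bar R}.
Hypothesis mu_haar : normalized_haar mu.
Local Open Scope complex_scope.
Local Notation V := (fine (mu (pball 0))).

Definition wavelet_center (k r : nat) : Qp p := k%:R / p%:R ^+ s + r%:R.

Definition wavelet_coef (j nu : 'I_p.-1) (k : 'I_(p ^ s)) (r : 'I_p) : R[i] :=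
  alpha sigma Z j nu k * expi2pi (nu.+1%:R * r%:R / p%:R).

Let p_gt0 : 0 < (p%:R : rat).
Proof. by rewrite ltr0n prime_gt0. Qed.

Lemma phi_pball (k r : nat) (x : Qp p) :
  phi R ((x - k%:R / p%:R ^+ s) / p%:R - r%:R / p%:R) =
  (\1_(pball (wavelet_center k r)) x)%:C.
Proof.
rewrite /phi !indicE; congr (nat_of_bool _)%:R%:C.
apply: asbool_equiv_eq; rewrite pballE // /unit_ball /= -mulrBl.
by rewrite /wavelet_center opprD addrA.
Qed.

(** A single sum over triples (nu, k, r) is the shape to which the results on linear combinations
    apply. *)
Lemma psiE (j : 'I_p.-1) (x : Qp p) : psi sigma Z j x =
  \sum_(t : 'I_p.-1 * 'I_(p ^ s) * 'I_p)
    wavelet_coef j t.1.1 t.1.2 t.2 *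
    (\1_(pball (wavelet_center t.1.2 t.2)) x)%:C.
Proof.
rewrite -(pair_bigA _ (fun u r => wavelet_coef j u.1 u.2 r *
    (\1_(pball (wavelet_center u.2 r)) x)%:C)) /=.
rewrite -(pair_bigA _ (fun nu k => \sum_(r < p) wavelet_coef j nu k r *
    (\1_(pball (wavelet_center k r)) x)%:C)) /=.
apply: eq_bigr => nu _; apply: eq_bigr => k _.
rewrite /psi0 mulr_sumr; apply: eq_bigr => r _.
by rewrite phi_pball mulrA.
Qed.

Lemma padic_abs_wavelet_center_le (k r : nat) :
  padic_abs (wavelet_center k r) <= p%:R ^+ s.
Proof.
have p1 : 1 <= (p%:R : rat) by rewrite ler1n prime_gt0.
rewrite padic_abs_le //; last exact: le_trans (padic_abs_nat_le1 _ _) (exprn_ege1 _ p1).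
rewrite padic_absM padic_absV padic_absX padic_abs_prime // exprVn invrK.
by rewrite ler_piMl ?padic_abs_nat_le1 // exprn_ge0 // ltW.
Qed.

Lemma padic_abs_fraction_gt1 (k : 'I_(p ^ s)) : (0 < k)%N ->
  1 < padic_abs (k%:R / p%:R ^+ s : Qp p).
Proof.
move=> k0; have := @padic_abs_expn_lt p p_prime s k; rewrite k0 ltn_ord => /(_ isT).
rewrite padic_absM padic_absV padic_absX padic_abs_prime // exprVn invrK.
by rewrite -ltr_pdivrMr ?exprn_gt0 // div1r.
Qed.

(** The first term is free of r, so that summing against roots of unity kills it; the second is the
    deviation of p Z_p itself. For k > 0, |k/p^s| > 1 >= |r| hides r; for k = 0 and r > 0, |r| =
    1. *)
Lemma ball_moment_wavelet_center m (k : 'I_(p ^ s)) (r : 'I_p) :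
  ball_moment mu m (wavelet_center k r) =
  (if (k == 0 :> nat)%N then 1 else ratr (padic_abs (k%:R / p%:R ^+ s : Qp p)) ^+ m) * V
  + (if (k == 0 :> nat)%N && (r == 0 :> nat)%N then ball_moment mu m 0 - V else 0).
Proof.
have [k0|k0] := eqVneq (k : nat) 0%N; last first.
  have k1 := padic_abs_fraction_gt1 (etrans (lt0n k) k0).
  have E : padic_abs (wavelet_center k r) = padic_abs (k%:R / p%:R ^+ s : Qp p).
    rewrite /wavelet_center addrC padic_absD_eq //.
    exact: le_lt_trans (padic_abs_nat_le1 _ _) k1.
  by rewrite addr0 (ball_moment_off0 mu_haar) E // ltW.
have -> : wavelet_center k r = r%:R by rewrite /wavelet_center k0 mul0r add0r.
rewrite mul1r; have [r0|r0] := eqVneq (r : nat) 0%N.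
  by rewrite r0 addrC subrK.
have r1 : padic_abs (r%:R : Qp p) = 1.
  by rewrite padic_abs_natlt // lt0n r0 ltn_ord.
by rewrite (ball_moment_off0 mu_haar) r1 // rmorph1 expr1n mul1r addr0.
Qed.

Lemma psi_moment m (j : 'I_p.-1) :
  complex_integral mu
    (fun x => (ratr (padic_abs x) ^+ m)%:C * psi sigma Z j x) =
  h_at0 sigma Z j * (ball_moment mu m 0 - V)%:C.
Proof.
pose c (t : 'I_p.-1 * 'I_(p ^ s) * 'I_p) := wavelet_coef j t.1.1 t.1.2 t.2.
pose a (t : 'I_p.-1 * 'I_(p ^ s) * 'I_p) := wavelet_center t.1.2 t.2.
have -> : (fun x => (ratr (padic_abs x) ^+ m)%:C * psi sigma Z j x) =
    (fun x => \sum_t c t * (ratr (padic_abs x) ^+ m * \1_(pball (a t)) x)%:C).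
  apply/funext => x; rewrite psiE mulr_sumr; apply: eq_bigr => t _.
  by rewrite rmorphM /= mulrCA.
rewrite complex_integral_lincomb; last first.
  by move=> t; exact: integrable_moment_indic.
transitivity (\sum_t c t * (ball_moment mu m (a t))%:C).
  by apply: eq_bigr => t _; rewrite Rintegral_moment_indic.
rewrite /c /a -(pair_bigA _ (fun u r => wavelet_coef j u.1 u.2 r *
    (ball_moment mu m (wavelet_center u.2 r))%:C)) /=.
rewrite -(pair_bigA _ (fun nu k => \sum_(r < p) wavelet_coef j nu k r *
    (ball_moment mu m (wavelet_center k r))%:C)) /=.
rewrite /h_at0 mulr_suml; apply: eq_bigr => nu _.
have ps0 : (0 < p ^ s)%N by rewrite expn_gt0 prime_gt0.
pose k0 := Ordinal ps0; pose r0 := Ordinal (prime_gt0 p_prime).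
(* The index [nu] encodes the frequency [nu.+1], which lies strictly between 0 and p, as the
   vanishing of the root sum requires. *)
have nup : (0 < nu.+1 < p)%N by rewrite /= -ltn_predRL.
have inner (k : 'I_(p ^ s)) : \sum_(r < p) wavelet_coef j nu k r *
      (ball_moment mu m (wavelet_center k r))%:C =
    if k == k0 then alpha sigma Z j nu 0 * (ball_moment mu m 0 - V)%:C else 0.
  under eq_bigr do rewrite ball_moment_wavelet_center rmorphD /= mulrDr.
  (* The part free of r carries the vanishing root sum as a factor; of the deviation only r = 0
     survives, and only for k = 0. *)
  rewrite big_split /= /wavelet_coef -mulr_suml -mulr_sumr sum_expi2pi //.
  rewrite mulr0 mul0r add0r (bigD1 r0) //= big1 ?addr0; last first.
    by move=> r; rewrite -val_eqE /= => /negbTE ->; rewrite andbF mulr0.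
  rewrite -val_eqE /= andbT; case: eqP => [->|_]; last by rewrite mulr0.
  by rewrite mulr0 mul0r expi2pi0 mulr1.
under eq_bigr do rewrite inner.
by rewrite -big_mkcond big_pred1_eq.
Qed.

(** Compact support and square integrability follow from the coset decomposition, which leaves the
    moment equations. *)
Lemma psi_vanishing_moments n (j : 'I_p.-1) :
  (forall m, (m < n)%N -> h_at0 sigma Z j * (ball_moment mu m 0 - V)%:C = 0) <->
  has_p_vanishing_moments mu n (psi sigma Z j).
Proof.
split=> [h|[_ _ h] m /h]; last by rewrite psi_moment.
split; last by move=> m /h; rewrite psi_moment.
(* Every coset involved lies in the disc of radius p^s: its centre does, and its points are at
   distance below 1 <= p^s from the centre. Outside the disc all indicators vanish. *)
- apply: (@compact_closure_sub_disc p p_prime _ s) => x; apply: contraPP => nx.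
  apply/negP; rewrite negbK psiE big1 // => t _.
  rewrite indicE memNset ?mulr0 // => xt; apply: nx.
  rewrite /padic_disc /= -(subrK (wavelet_center t.1.2 t.2) x) padic_abs_le //.
    by apply: le_trans (ltW xt) _; rewrite exprn_ege1 // ler1n prime_gt0.
  exact: padic_abs_wavelet_center_le.
- have -> : psi sigma Z j = (fun x => \sum_t wavelet_coef j t.1.1 t.1.2 t.2 *
    (\1_(pball (wavelet_center t.1.2 t.2)) x)%:C) by apply/funext => x; exact: psiE.
  apply: (@square_integrable_lincomb R p mu _
    (index_enum ('I_p.-1 * 'I_(p ^ s) * 'I_p)%type)
    (fun t => wavelet_coef j t.1.1 t.1.2 t.2)
    (fun t => pball (wavelet_center t.1.2 t.2))).
    by move=> t; exact: measurable_pball.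
  by move=> t; exact: mu_pball_lty.
Qed.

End WaveletMoments.

Theorem theorem5p2 (R : realType) (p s : nat) (p_prime : prime p)
    (sigma : 'I_p.-1 -> 'I_(p ^ s) -> R[i])
    (sigma_norm1 : forall j m, `|sigma j m| = 1)
    (Z : 'M[R[i]]_p.-1) (Z_unitary : Z \is unitarymx)
    (mu : {measure set (Qp_borel p) -> \bar R})
    (mu_haar : normalized_haar mu) :
  (forall j : 'I_p.-1, has_p_vanishing_moments mu 1 (psi sigma Z j)) /\
  (forall j : 'I_p.-1,
     has_infinite_p_vanishing_moments mu (psi sigma Z j) <->
     h_at0 sigma Z j = 0).
Proof.
have moments n j := psi_vanishing_moments p_prime sigma Z mu_haar n j.
split=> j.
  (* Only m = 0 occurs, where the moment over p Z_p equals its measure and the second factor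
     vanishes. *)
  by apply/moments => -[|//] _; rewrite ball_moment0 // subrr mulr0.
(* Order 2 makes the equation for m = 1 available; there the second factor is negative, which forces
   h_j(0) = 0. *)
split=> [/(_ 2%N isT)/moments/(_ 1%N isT)/eqP|h0 n _]; last first.
  by apply/moments => m _; rewrite h0 mul0r.
rewrite mulf_eq0 => /orP[/eqP //|/eqP[/eqP]].
by rewrite subr_eq0 lt_eqF // ball_moment_lt.
Qed.
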